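(* Let $\lambda$ be a nonzero real number and let $r\ge 1$ be an integer. For every integer $n\ge 0$, $$D_{n,\lambda}^{(r)}=\sum_{l_{1}+\cdots+l_{r}=n}\binom{n}{l_{1},\ldots,l_{r}}D_{l_{1},\lambda}\cdots D_{l_{r},\lambda} =\sum_{m=0}^{n}\lambda^{m}\sum_{l_{1}+\cdots+l_{r}=m}\binom{m}{l_{1},\ldots,l_{r}}\frac{S_{1}(n+r,m+r)}{(l_{1}+1)\cdots(l_{r}+1)}\cdot\frac{\binom{m+r}{r}}{\binom{n+r}{r}},$$ where the sums over $l_1,\ldots,l_r$ run over nonnegative integers.
   Context: Generating functions are power series in $t$ (formal, or convergent for $|t|$ small), with $(1+t)^{x}=\sum_{n\ge 0}(x)_n\frac{t^n}{n!}$, where $(x)_0=1$ and $(x)_n=x(x-1)\cdots(x-n+1)$ for $n\ge1$. The degenerate logarithm is $\log_\lambda(1+t)=\frac{1}{\lambda}\left((1+t)^\lambda-1\right)$. The degenerate Daehee numbers $D_{n,\lambda}$ are defined by $\frac{\log_\lambda(1+t)}{t}=\sum_{n=0}^\infty D_{n,\lambda}\frac{t^n}{n!}$. The degenerate Daehee polynomials of order $r$ are defined by $$\sum_{n=0}^{\infty}D_{n,\lambda}^{(r)}(x)\frac{t^{n}}{n!}=\left(\frac{\log(1+t)}{t}\right)^{r}\int_{0}^{1}\cdots\int_{0}^{1}(1+t)^{\lambda(x_{1}+\cdots+x_{r})+x}dx_{1}\cdots dx_{r}=\left(\frac{\log_{\lambda}(1+t)}{t}\right)^{r}(1+t)^{x},$$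 and the degenerate Daehee numbers of order $r$ are $D_{n,\lambda}^{(r)}=D_{n,\lambda}^{(r)}(0)$. The (signed) Stirling numbers of the first kind $S_1(n,l)$ are defined by $(x)_n=\sum_{l=0}^n S_1(n,l)x^l$ for $n\ge 0$. The multinomial coefficient is $\binom{m}{l_1,\ldots,l_r}=\frac{m!}{l_1!\cdots l_r!}$ when $l_1+\cdots+l_r=m$. *)

(* Defs.v *)
From HB Require Import structures.
From mathcomp Require Import all_boot all_order all_algebra.
From mathcomp Require Import reals.
Set Implicit Arguments.
Unset Strict Implicit.
Unset Printing Implicit Defensive.
Import Order.TTheory GRing.Theory Num.Theory.
Local Open Scope ring_scope.

(* A formal power series f is its sequence of coefficients: f n is the        *)
(* coefficient of t^n.                                                        *)
Definition fps (R : realType) := nat -> R.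

Section FormalPowerSeries.
Variable R : realType.
Implicit Types (f g : fps R) (c : R) (n : nat).

Definition fps_one : fps R := fun n => (n == 0)%N%:R.

Definition fps_t : fps R := fun n => (n == 1)%N%:R.

Definition fps_sub f g : fps R := fun n => f n - g n.

Definition fps_scale c f : fps R := fun n => c * f n.

Definition fps_mul f g : fps R :=
  fun n => \sum_(i < n.+1) f i * g (n - i)%N.

Definition fps_exp f (r : nat) : fps R := iter r (fps_mul f) fps_one.

(* The quotient f / t. It is meaningful only if f has no constant term;       *)
(* see fps_divtK.                                                             *)
Definition fps_divt f : fps R := fun n => f n.+1.

(* The coefficient a_n of f = \sum_n a_n t^n / n!.                            *)
Definition egf_coef f n : R := n`!%:R * f n.

Lemma fps_divtK f : f 0%N = 0 -> fps_mul fps_t (fps_divt f) =1 f.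
Proof.
move=> f0 [|n]; rewrite /fps_mul /fps_t /fps_divt.
  by rewrite big_ord1 mul0r f0.
rewrite big_ord_recl big_ord_recl big1 => [|i _]; last by rewrite mul0r.
by rewrite mul0r add0r addr0 mul1r subSS subn0.
Qed.

Lemma egf_coefP f (a : nat -> R) :
  (forall n, f n = a n * n`!%:R^-1) <-> (forall n, a n = egf_coef f n).
Proof.
have nz n : n`!%:R != 0 :> R by rewrite pnatr_eq0 -lt0n fact_gt0.
split=> H n; first by rewrite /egf_coef H mulrC mulfVK.
by rewrite H /egf_coef mulrC mulKf.
Qed.

End FormalPowerSeries.

Definition falling (A : nzRingType) (x : A) (n : nat) : A :=
  \prod_(i < n) (x - i%:R).

(* Signed Stirling number of the first kind: the coefficient of X^l in (X)_n. *)
Definition stirling1 (n l : nat) : int := (falling ('X : {poly int}) n)`_l.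

Lemma falling_stirling1 (A : comNzRingType) (x : A) (n : nat) :
  falling x n = \sum_(l < n.+1) (stirling1 n l)%:~R * x ^+ l.
Proof.
have sz : size (falling ('X : {poly int}) n) = n.+1.
  rewrite /falling (eq_bigr (fun i : 'I_n => 'X - (i%:R : int)%:P)).
    by rewrite -big_enum size_prod_XsubC size_enum_ord.
  by move=> i _; rewrite polyC_natr.
have -> : falling x n = (map_poly intr (falling ('X : {poly int}) n)).[x].
  rewrite /falling rmorph_prod horner_prod; apply: eq_bigr => i _.
  by rewrite rmorphB /= map_polyX rmorph_nat hornerD hornerN hornerX -polyC_natr hornerC.
rewrite (@horner_coef_wide _ n.+1) ?(leq_trans (size_poly _ _)) ?sz //.
by apply: eq_bigr => l _; rewrite coef_map.
Qed.

Section Daehee.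
Variable R : realType.
Implicit Types (lambda x : R) (r n : nat).

(* (1 + t)^x = \sum_n (x)_n t^n / n!                                          *)
Definition fps_pow1t x : fps R := fun n => falling x n / n`!%:R.

Definition fps_dlog lambda : fps R :=
  fps_scale lambda^-1 (fps_sub (fps_pow1t lambda) (@fps_one R)).

Lemma fps_dlog0 lambda : fps_dlog lambda 0%N = 0.
Proof.
by rewrite /fps_dlog /fps_scale /fps_sub /fps_pow1t /fps_one /falling
  big_ord0 divr1 subrr mulr0.
Qed.

Definition daehee lambda n : R := egf_coef (fps_divt (fps_dlog lambda)) n.

Definition daehee_poly lambda r x n : R :=
  egf_coef (fps_mul (fps_exp (fps_divt (fps_dlog lambda)) r) (fps_pow1t x)) n.

Definition daehee_num lambda r n : R := daehee_poly lambda r 0 n.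

Definition multinomial r m (l : 'I_r -> nat) : R :=
  m`!%:R / \prod_(i < r) (l i)`!%:R.

End Daehee.

(* Sum of F l over all r-tuples l of natural numbers with l_1 + ... + l_r = m;*)
(* each l_i is then at most m, so the tuples range over a finite type.        *)
Definition sum_compositions (R : realType) (r m : nat)
    (F : ('I_r -> nat) -> R) : R :=
  \sum_(l : {ffun 'I_r -> 'I_m.+1} | (\sum_(i < r) l i)%N == m)
    F (fun i => l i : nat).

(* Main.v *)
Require Import Defs.
From mathcomp Require Import all_boot all_order all_algebra.
From mathcomp Require Import reals.
From mathcomp Require Import ring.
Import Order.TTheory GRing.Theory Num.Theory.
Local Open Scope ring_scope.

(** The first equality is the expansion of a power of a series as a sum over
    compositions ([fps_exp_compositions]), with the factorials of exponential
    generating functions put back in.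

    For the second one, let [E_c(x) = (1 + c t)^(x/c)], read as [exp(x t)] when
    [c = 0].  For each [c] these series satisfy [E_c(x) E_c(y) = E_c(x + y)], so
    that multiplying by [E_c(h) - 1] is taking the forward difference of step
    [h] in the exponent; hence the coefficient of [t^N] in [(E_c(h) - 1)^r] is
    the [r]-th difference at [0] of the function sending [x] to the coefficient
    of [t^N] in [E_c(x)] ([fps_exp_dexp]).

    For [c = 1] and [h = lambda] the power is that of [lambda log_lambda(1+t)].
    The function of [x] is then [(x)_N / N!], the combination, with
    coefficients [S_1(N, j) j! / N!], of the functions [x^j / j!], which are those that
    come with [c = 0].  Differences being linear, the coefficient of [t^N] in
    [(lambda log_lambda(1+t))^r] is the same combination of coefficients of
    [(exp(lambda t) - 1)^r] ([fps_exp_pow1t]).  It remains to divide both series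
    by [t], which shifts [N = n + r] to [n] and [j = m + r] to [m]
    ([fps_exp_divt]), and to expand both powers over compositions: the series
    [(exp(lambda t) - 1) / t] has coefficients [lambda^(l+1) / (l+1)!]. *)

(** * Powers of formal power series *)

Section HigherOrderDaehee.
Variable R : realType.
Implicit Types (f g : fps R) (c h x y lambda : R) (phi : R -> R) (r n m : nat).

Lemma fps_expS f r n : fps_exp f r.+1 n = \sum_(i < n.+1) f i * fps_exp f r (n - i)%N.
Proof. by []. Qed.

Lemma eq_fps_mul f f' g g' : f =1 f' -> g =1 g' -> fps_mul f g =1 fps_mul f' g'.
Proof. by move=> ff' gg' n; apply: eq_bigr => i _; rewrite ff' gg'. Qed.

Lemma eq_fps_exp f f' r : f =1 f' -> fps_exp f r =1 fps_exp f' r.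
Proof. by move=> ff'; elim: r => //= r IHr; apply: eq_fps_mul. Qed.

Lemma fps_mulr1 f : fps_mul f (@fps_one R) =1 f.
Proof.
move=> n; rewrite /fps_mul big_ord_recr /= subnn mulr1 big1 ?add0r // => i _.
by rewrite /fps_one subn_eq0 leqNgt ltn_ord mulr0.
Qed.

Lemma fps_mul1r f : fps_mul (@fps_one R) f =1 f.
Proof.
move=> n; rewrite /fps_mul big_ord_recl mul1r subn0 big1 ?addr0 // => i _.
by rewrite mul0r.
Qed.

Lemma fps_exp_scale a f r n :
  fps_exp (fps_scale a f) r n = a ^+ r * fps_exp f r n.
Proof.
elim: r n => [|r IHr] n; first by rewrite mul1r.
rewrite !fps_expS mulr_sumr; apply: eq_bigr => i _.
by rewrite IHr /fps_scale exprS mulrACA.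
Qed.

(** Coefficients of index below [N] only depend on the truncation at [N], which
    turns powers of series into powers of polynomials. *)
Lemma fps_exp_poly f N r n :
  (n < N)%N -> fps_exp f r n = ((\poly_(i < N) f i) ^+ r)`_n.
Proof.
elim: r n => [|r IHr] n ltnN; first by rewrite expr0 coef1.
rewrite fps_expS exprS coefM; apply: eq_bigr => i _.
rewrite coef_poly (leq_ltn_trans _ ltnN) ?(leq_ord i) //.
by rewrite IHr // (leq_ltn_trans (leq_subr _ _)).
Qed.

Lemma fps_exp_compositions f r n :
  fps_exp f r n = sum_compositions n (fun l : 'I_r -> nat => \prod_(i < r) f (l i)).
Proof.
rewrite (@fps_exp_poly _ n.+1) // poly_def.
have -> (p : {poly R}) : p ^+ r = \prod_(i < r) p.
  by rewrite prodr_const card_ord.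
rewrite bigA_distr_bigA coef_sum /sum_compositions /= big_mkcond [RHS]big_mkcond /=.
apply: eq_bigr => l _.
by rewrite scaler_prod prodrXr coefZ coefXn eq_sym; case: eqP; rewrite (mulr1, mulr0).
Qed.

(** On truncations, [f = t (f / t)] reads as a factor ['X], whose [r]-th power
    comes out and shifts the coefficients by [r]. *)
Lemma fps_exp_divt f r n : f 0%N = 0 ->
  fps_exp f r n = if (n < r)%N then 0 else fps_exp (fps_divt f) r (n - r)%N.
Proof.
move=> f0; rewrite (@fps_exp_poly f n.+2) //.
have -> : \poly_(i < n.+2) f i = 'X * \poly_(i < n.+1) fps_divt f i.
  by apply/polyP => -[|i]; rewrite coefXM !coef_poly /= ?f0.
by rewrite exprMn coefXnM (@fps_exp_poly _ n.+1) // ltnS leq_subr.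
Qed.

(** * Differences in the exponent *)

Definition fdiff h phi : R -> R := fun x => phi (x + h) - phi x.

Lemma iter_fdiff_sum h r k (a : 'I_k -> R) (phi : 'I_k -> R -> R) psi x :
    (forall y, psi y = \sum_(i < k) a i * phi i y) ->
  iter r (fdiff h) psi x = \sum_(i < k) a i * iter r (fdiff h) (phi i) x.
Proof.
move=> psiE; elim: r x => [|r IHr] x; first exact: psiE.
rewrite iterS {1}/fdiff !IHr -sumrB; apply: eq_bigr => i _.
by rewrite -mulrBr.
Qed.

(** The series [(1 + c t)^(x/c)], which is [exp(x t)] for [c = 0].  The step [c]
    is kept general because both values [0] and [1] are used. *)
Definition dexp c x : fps R := fun n => (\prod_(i < n) (x - c * i%:R)) / n`!%:R.

Lemma dexp0 c x : dexp c x 0%N = 1.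
Proof. by rewrite /dexp big_ord0 divr1. Qed.

Lemma dexpS c x n : n.+1%:R * dexp c x n.+1 = (x - c * n%:R) * dexp c x n.
Proof.
rewrite /dexp big_ord_recr /= factS natrM.
have n1 : n.+1%:R != 0 :> R by rewrite pnatr_eq0.
have nf : n`!%:R != 0 :> R by rewrite pnatr_eq0 -lt0n fact_gt0.
by field; rewrite nf addrC natr1 n1.
Qed.

Lemma dexp1 x n : dexp 1 x n = fps_pow1t x n.
Proof. by congr (_ / _); apply: eq_bigr => i _; rewrite mul1r. Qed.

Lemma dexp_exp x n : dexp 0 x n = x ^+ n / n`!%:R.
Proof.
congr (_ / _); rewrite (eq_bigr (fun=> x)) => [|i _]; last by rewrite mul0r subr0.
by rewrite prodr_const card_ord.
Qed.

Lemma dexp_id0 c : dexp c 0 =1 @fps_one R.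
Proof.
move=> [|n]; first by rewrite dexp0.
by rewrite /dexp big_ord_recl mulr0 subr0 !mul0r.
Qed.

(** The recursion [dexpS] determines the series: it holds for the product with
    [x + y] in place of [x], since the terms [x - c i] and [y - c (n - i)] that
    it yields on the two factors add up to [x + y - c n] for every [i]. *)
Lemma dexpD c x y : fps_mul (dexp c x) (dexp c y) =1 dexp c (x + y).
Proof.
elim=> [|n IHn]; first by rewrite /fps_mul big_ord1 !dexp0 mulr1.
have n1 : n.+1%:R != 0 :> R by rewrite pnatr_eq0.
apply: (mulfI n1); rewrite dexpS -IHn /fps_mul !mulr_sumr.
transitivity (\sum_(i < n.+2) ((i%:R * dexp c x i) * dexp c y (n.+1 - i)%N
    + dexp c x i * ((n.+1 - i)%N%:R * dexp c y (n.+1 - i)%N))).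
  apply: eq_bigr => i _.
  have -> : n.+1%:R = i%:R + (n.+1 - i)%N%:R :> R by rewrite -natrD subnKC // leq_ord.
  by ring.
rewrite big_split /= big_ord_recl [X in _ + X]big_ord_recr /= subnn !mul0r mulr0 addr0 add0r.
rewrite -big_split /=; apply: eq_bigr => i _.
rewrite /bump /= add1n subSS subSn ?leq_ord // !dexpS.
have -> : n%:R = i%:R + (n - i)%N%:R :> R by rewrite -natrD subnKC // leq_ord.
by ring.
Qed.

(** Multiplying by [dexp c h - 1] sends [dexp c x] to
    [dexp c (x + h) - dexp c x]: each factor is one difference in the exponent. *)
Lemma fps_exp_dexp c h r n :
  fps_exp (fps_sub (dexp c h) (@fps_one R)) r n =
  iter r (fdiff h) (fun x => dexp c x n) 0.
Proof.
elim: r n => [|r IHr] n; first by rewrite /= dexp_id0.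
rewrite fps_expS iterSr (@iter_fdiff_sum _ _ n.+1 (fps_sub (dexp c h) (@fps_one R))
  (fun i x => dexp c x (n - i)%N)).
  by apply: eq_bigr => i _; rewrite IHr.
move=> x; rewrite /fdiff [x + h]addrC -dexpD -[dexp c x n]fps_mul1r -sumrB.
by apply: eq_bigr => i _; rewrite -mulrBl.
Qed.

(** As a function of the exponent, the coefficient of [t^n] in [(1 + t)^x] is a
    combination of those of the series [exp(x t)], and taking differences
    preserves this relation. *)
Lemma fps_exp_pow1t h r n :
  fps_exp (fps_sub (fps_pow1t h) (@fps_one R)) r n =
  \sum_(j < n.+1) (stirling1 n j)%:~R * j`!%:R / n`!%:R *
    fps_exp (fps_sub (dexp 0 h) (@fps_one R)) r j.
Proof.
have E1 : fps_sub (fps_pow1t h) (@fps_one R) =1 fps_sub (dexp 1 h) (@fps_one R).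
  by move=> k; rewrite /fps_sub dexp1.
rewrite (eq_fps_exp _ _ _ E1) fps_exp_dexp.
rewrite (@iter_fdiff_sum _ _ n.+1 (fun j => (stirling1 n j)%:~R * j`!%:R / n`!%:R)
  (fun j x => dexp 0 x j)).
  by apply: eq_bigr => j _; rewrite fps_exp_dexp.
move=> x; rewrite dexp1 /fps_pow1t falling_stirling1 mulr_suml.
apply: eq_bigr => j _; rewrite dexp_exp.
have nf k : k`!%:R != 0 :> R by rewrite pnatr_eq0 -lt0n fact_gt0.
by field; rewrite !nf.
Qed.

(** * Daehee numbers of higher order *)

Lemma compositions_daehee lambda r n :
  sum_compositions n (fun l : 'I_r -> nat =>
    multinomial R n l * \prod_(i < r) daehee lambda (l i)) =
  n`!%:R * fps_exp (fps_divt (fps_dlog lambda)) r n.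
Proof.
rewrite fps_exp_compositions /sum_compositions mulr_sumr; apply: eq_bigr => l _.
rewrite /multinomial /daehee /egf_coef big_split /= mulrA divfK //.
by apply/prodf_neq0 => i _; rewrite pnatr_eq0 -lt0n fact_gt0.
Qed.

Lemma fps_exp_expB1 lambda r m :
  fps_exp (fps_sub (dexp 0 lambda) (@fps_one R)) r (m + r)%N =
  lambda ^+ (m + r) *
  sum_compositions m (fun l : 'I_r -> nat => (\prod_(i < r) (l i).+1`!%:R)^-1).
Proof.
rewrite fps_exp_divt; last by rewrite /fps_sub dexp0 subrr.
rewrite ltnNge leq_addl /= addnK fps_exp_compositions /sum_compositions mulr_sumr.
apply: eq_bigr => l /eqP suml.
rewrite (eq_bigr (fun i => lambda ^+ (l i).+1 / (l i).+1`!%:R)) => [|i _]; last first.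
  by rewrite /fps_divt /fps_sub dexp_exp subr0.
rewrite big_split /= prodfV prodrXr; congr (_ ^+ _ / _).
rewrite (eq_bigr (fun i => l i + 1)%N) => [|i _]; last by rewrite addn1.
by rewrite big_split /= suml sum1_card card_ord.
Qed.

(** The identity [lambda log_lambda(1+t) = (1+t)^lambda - 1], divided by [t] and
    raised to the power [r]; the right-hand side is then read off from
    [fps_exp_pow1t]. *)
Lemma fps_exp_dlog lambda r n : lambda != 0 ->
  lambda ^+ r * fps_exp (fps_divt (fps_dlog lambda)) r n =
  \sum_(m < n.+1) (stirling1 (n + r) (m + r))%:~R * (m + r)`!%:R / (n + r)`!%:R *
    fps_exp (fps_sub (dexp 0 lambda) (@fps_one R)) r (m + r)%N.
Proof.
move=> lambda0; rewrite -fps_exp_scale.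
have E1 : fps_scale lambda (fps_divt (fps_dlog lambda)) =1
    fps_divt (fps_sub (fps_pow1t lambda) (@fps_one R)).
  by move=> k; rewrite /fps_scale /fps_divt /fps_dlog /fps_scale mulVKf.
rewrite (eq_fps_exp _ _ _ E1).
have P0 : fps_sub (fps_pow1t lambda) (@fps_one R) 0%N = 0.
  by rewrite /fps_sub -dexp1 dexp0 subrr.
have := fps_exp_divt _ r (n + r)%N P0.
rewrite ltnNge leq_addl /= addnK => <-.
rewrite fps_exp_pow1t -addSn -(big_mkord xpredT (fun j =>
  (stirling1 (n + r) j)%:~R * j`!%:R / (n + r)`!%:R *
    fps_exp (fps_sub (dexp 0 lambda) (@fps_one R)) r j)).
(* The series [exp(lambda t) - 1] has no constant term: the terms with j < r
   vanish, and the others are reindexed by j = m + r. *)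
rewrite (@big_cat_nat _ _ _ r) ?leq_addl //= big_nat_cond big1 ?add0r; last first.
  move=> j /andP[/andP[_ ltjr] _]; rewrite fps_exp_divt ?ltjr ?mulr0 //.
  by rewrite /fps_sub dexp0 subrr.
by rewrite -{1}[r]add0n big_addn addnK big_mkord.
Qed.

End HigherOrderDaehee.

Theorem theorem3p4 (R : realType) (lambda : R) (r : nat)
    (hlambda : lambda != 0) (hr : (1 <= r)%N) (n : nat) :
  daehee_num lambda r n =
    sum_compositions n (fun l : 'I_r -> nat =>
      multinomial R n l * \prod_(i < r) daehee lambda (l i))
  /\
  sum_compositions n (fun l : 'I_r -> nat =>
      multinomial R n l * \prod_(i < r) daehee lambda (l i)) =
    \sum_(0 <= m < n.+1) lambda ^+ m *
      sum_compositions m (fun l : 'I_r -> nat =>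
        multinomial R m l
        * ((stirling1 (n + r) (m + r))%:~R / \prod_(i < r) (l i).+1%:R)
        * ('C(m + r, r)%:R / 'C(n + r, r)%:R)).
Proof.
rewrite compositions_daehee; split.
  rewrite /daehee_num /daehee_poly /egf_coef; congr (_ * _).
  rewrite -[RHS]fps_mulr1; apply: eq_fps_mul => // k.
  by rewrite -dexp1 dexp_id0.
apply: (mulfI (expf_neq0 r hlambda)).
rewrite mulrCA fps_exp_dlog // big_mkord !mulr_sumr; apply: eq_bigr => m _.
rewrite fps_exp_expB1 /sum_compositions exprD !mulr_sumr; apply: eq_bigr => l _.
have nf k : k`!%:R != 0 :> R by rewrite pnatr_eq0 -lt0n fact_gt0.
have binE k : 'C(k + r, r)%:R = (k + r)`!%:R / (r`!%:R * k`!%:R) :> R.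
  rewrite -(bin_fact (leq_addl k r)) addnK !natrM mulfK //.
  by rewrite mulf_neq0.
have -> : \prod_(i < r) (l i).+1`!%:R =
    \prod_(i < r) (l i).+1%:R * \prod_(i < r) (l i)`!%:R :> R.
  by rewrite -big_split; apply: eq_bigr => i _; rewrite factS natrM.
have P1 : \prod_(i < r) (l i).+1%:R != 0 :> R.
  by apply/prodf_neq0 => i _; rewrite pnatr_eq0.
have P2 : \prod_(i < r) (l i)`!%:R != 0 :> R by apply/prodf_neq0.
by rewrite !binE /multinomial; field; rewrite P1 P2 !nf.
Qed.
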